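(* Let $p$ be an odd prime. Then, as formal power series in $z$, $$\sum_{n\ge 0}\mathbf G_n(p)\frac{z^n}{n!}=1+\sum_{\ell\ge 1}p^\ell D_\ell(z).$$ Consequently, if $1\le n\le p-2$ and $M\ge 1$, then $$\mathbf G_n(p)\equiv n!\sum_{\ell=1}^{M}p^\ell\,[z^n]D_\ell(z)\pmod{p^{M+1}}\qquad\text{in }\mathbb Z_{(p)}[i].$$
   Context: Here $i^2=-1$, and $\mathbf G_n(p)=\sum_{a=1}^{p-1}\sum_{b=1}^{p-1}(a+bi)^n\in\mathbb Z[i]$. Put $Q(z)=\frac{1}{e^z-1}=z^{-1}-\frac12+O(z)$ (a formal Laurent series over $\mathbb Q$) and, for $\ell\ge1$, $C_\ell(z)=\frac{z^\ell}{\ell!}Q(z)\in z^{\ell-1}\mathbb Q[[z]]$. For $\ell\ge 1$ define the formal power series over $\mathbb Q(i)$ $$D_\ell(z)=-C_\ell(z)-C_\ell(iz)+\sum_{a=1}^{\ell-1}C_a(z)C_{\ell-a}(iz).$$ $[z^n]F(z)$ denotes the coefficient of $z^n$ in $F(z)$. The infinite sum over $\ell$ is understood coefficientwise (each coefficient of $z^n$ receives only finitely many nonzero contributions). $\mathbb Z_{(p)}$ is the localization of $\mathbb Z$ at $(p)$, and $x\equiv y\pmod{p^k}$ in $\mathbb Z_{(p)}[i]$ means $x-y\in p^k\mathbb Z_{(p)}[i]$. *)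

(* Defs.v *)
From HB Require Import structures.
From mathcomp Require Import all_boot all_order all_algebra.
From mathcomp Require Import boolp classical_sets.
From mathcomp Require Import complex.

Set Implicit Arguments.
Unset Strict Implicit.
Unset Printing Implicit Defensive.

Import Order.TTheory GRing.Theory Num.Theory.

Local Open Scope ring_scope.

(* [fps F] is F[[z]]; [fps_coef f n] is the coefficient [z^n] f. *)
Record fps (F : Type) := FPS { fps_coef : nat -> F }.

Lemma fpsP (F : Type) (f g : fps F) : fps_coef f =1 fps_coef g <-> f = g.
Proof.
split=> [|-> //]; case: f g => [f] [g] /= fg.
by congr FPS; apply/funext.
Qed.

HB.instance Definition _ (F : Type) := gen_eqMixin (fps F).
HB.instance Definition _ (F : Type) := gen_choiceMixin (fps F).

Module FpsRing.
Section FpsRing.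
Variable F : fieldType.
Implicit Types f g h : fps F.

Definition zero : fps F := FPS (fun=> 0).
Definition opp f := FPS (fun n => - fps_coef f n).
Definition add f g := FPS (fun n => fps_coef f n + fps_coef g n).

Lemma addA : associative add.
Proof. by move=> f g h; apply/fpsP => n /=; rewrite addrA. Qed.
Lemma addC : commutative add.
Proof. by move=> f g; apply/fpsP => n /=; rewrite addrC. Qed.
Lemma add0 : left_id zero add.
Proof. by move=> f; apply/fpsP => n /=; rewrite add0r. Qed.
Lemma addN : left_inverse zero opp add.
Proof. by move=> f; apply/fpsP => n /=; rewrite addNr. Qed.

HB.instance Definition _ := GRing.isZmodule.Build (fps F) addA addC add0 addN.

Definition one : fps F := FPS (fun n => (n == 0%N)%:R).
Definition mul f g :=
  FPS (fun n => \sum_(i < n.+1) fps_coef f i * fps_coef g (n - i)).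

Definition trunc n f : {poly F} := \poly_(i < n.+1) fps_coef f i.

Lemma coef_trunc n f k : (k <= n)%N -> (trunc n f)`_k = fps_coef f k.
Proof. by move=> kn; rewrite coef_poly ltnS kn. Qed.

Lemma coef_mul_poly n (p q : {poly F}) f g :
    (forall k, (k <= n)%N -> p`_k = fps_coef f k) ->
    (forall k, (k <= n)%N -> q`_k = fps_coef g k) ->
  forall k, (k <= n)%N -> (p * q)`_k = fps_coef (mul f g) k.
Proof.
move=> pf qg k kn; rewrite coefM; apply: eq_bigr => i _.
rewrite pf ?qg //; first exact: leq_trans (leq_subr _ _) kn.
by apply: leq_trans kn; rewrite -ltnS.
Qed.

Lemma mulA : associative mul.
Proof.
move=> f g h; apply/fpsP => n.
have T u k : (k <= n)%N -> (trunc n u)`_k = fps_coef u k by apply: coef_trunc.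
rewrite -(coef_mul_poly (T f) (coef_mul_poly (T g) (T h)) (leqnn n)).
by rewrite -(coef_mul_poly (coef_mul_poly (T f) (T g)) (T h) (leqnn n)) mulrA.
Qed.

Lemma mulC : commutative mul.
Proof.
move=> f g; apply/fpsP => n.
have T u k : (k <= n)%N -> (trunc n u)`_k = fps_coef u k by apply: coef_trunc.
rewrite -(coef_mul_poly (T f) (T g) (leqnn n)) mulrC.
exact: (coef_mul_poly (T g) (T f) (leqnn n)).
Qed.

Lemma mul1 : left_id one mul.
Proof.
move=> f; apply/fpsP => n /=.
by rewrite big_ord_recl /= mul1r subn0 big1 ?addr0 // => i _; rewrite mul0r.
Qed.

Lemma mulDl : left_distributive mul add.
Proof.
move=> f g h; apply/fpsP => n /=; rewrite -big_split /=.
by apply: eq_bigr => i _; rewrite mulrDl.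
Qed.

Lemma one_neq0 : one != zero.
Proof.
by apply/eqP => /fpsP/(_ 0%N) /= /eqP; rewrite oner_eq0.
Qed.

HB.instance Definition _ :=
  GRing.Zmodule_isComNzRing.Build (fps F) mulA mulC mul1 mulDl one_neq0.

Lemma coefM f g n :
  fps_coef (f * g) n = \sum_(i < n.+1) fps_coef f i * fps_coef g (n - i).
Proof. by []. Qed.

Definition unit : {pred fps F} := fun f => fps_coef f 0 != 0.

Fixpoint inv_seq f n : seq F :=
  if n is m.+1 then
    let s := inv_seq f m in
    rcons s (((m == 0)%:R - \sum_(i < m) s`_i * fps_coef f (m - i))
             / fps_coef f 0)
  else [::].

Definition inv_unit f := FPS (fun n => (inv_seq f n.+1)`_n).

Definition inv f := if unit f then inv_unit f else f.

Lemma size_inv_seq f n : size (inv_seq f n) = n.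
Proof. by elim: n => //= n IHn; rewrite size_rcons IHn. Qed.

Lemma nth_inv_seq f n k : (k < n)%N -> (inv_seq f n)`_k = (inv_seq f k.+1)`_k.
Proof.
elim: n => // n IHn; rewrite ltnS leq_eqVlt => /orP[/eqP-> //|kn].
by rewrite -IHn //= nth_rcons size_inv_seq kn.
Qed.

Lemma mulVx : {in unit, left_inverse (1 : fps F) inv *%R}.
Proof.
move=> f; rewrite /in_mem /= => uf; apply/fpsP => n; rewrite /inv uf.
rewrite coefM big_ord_recr /= subnn.
rewrite nth_rcons size_inv_seq ltnn eqxx divfK //.
rewrite addrC -addrA -[RHS]addr0; congr (_ + _); apply/eqP.
rewrite addrC subr_eq0; apply/eqP; apply: eq_bigr => i _.
by rewrite (@nth_inv_seq f n).
Qed.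

Lemma unitPl f g : g * f = 1 -> unit f.
Proof.
move=> /fpsP/(_ 0%N); rewrite coefM big_ord1 /= => e.
by apply/eqP => f0; move: e => /eqP; rewrite f0 mulr0 eq_sym oner_eq0.
Qed.

Lemma inv_out : {in [predC unit], inv =1 id}.
Proof. by move=> f nf; rewrite /inv ifN. Qed.

HB.instance Definition _ :=
  GRing.ComNzRing_hasMulInverse.Build (fps F) mulVx unitPl inv_out.

Lemma fps_order f : f != 0 ->
  exists2 m, fps_coef f m != 0 & forall k, (k < m)%N -> fps_coef f k = 0.
Proof.
move=> f0; have ex : exists n, fps_coef f n != 0.
  apply: contrapT => /forallNP nf; case/eqP: f0; apply/fpsP => n /=.
  by have /negP := nf n; rewrite negbK => /eqP.
exists (ex_minn ex); first by case: ex_minnP.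
move=> k; case: ex_minnP => m _ mP km.
by apply/eqP; apply: contraTT km => /mP; rewrite -leqNgt.
Qed.

Lemma mul_integral (f g : fps F) : f * g = 0 -> (f == 0) || (g == 0).
Proof.
move=> fg0; case: (eqVneq f 0) => //= /fps_order[a fa fP].
case: (eqVneq g 0) => //= /fps_order[b gb gP].
have := (fpsP (f * g) 0).2 fg0 (a + b)%N.
rewrite coefM.
have aP : (a < (a + b).+1)%N by rewrite ltnS leq_addr.
rewrite (bigD1 (Ordinal aP)) //= addKn big1 => [|i /negP ia].
  by move/eqP; rewrite addr0 mulf_eq0 (negbTE fa) (negbTE gb).
have [/fP->|ai] := ltnP i a; first by rewrite mul0r.
rewrite gP ?mulr0 //; have {}ai : (a < i)%N.
  by rewrite ltn_neqAle ai andbT; apply/negP => /eqP e; apply/ia/eqP/val_inj.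
by rewrite ltn_subLR ?ltn_add2r // -ltnS.
Qed.

HB.instance Definition _ :=
  GRing.ComUnitRing_isIntegral.Build (fps F) mul_integral.

End FpsRing.
End FpsRing.
HB.export FpsRing.

Lemma fps_coef0 (F : fieldType) n : fps_coef (0 : fps F) n = 0.
Proof. by []. Qed.

Lemma fps_coef1 (F : fieldType) n : fps_coef (1 : fps F) n = (n == 0%N)%:R.
Proof. by []. Qed.

Lemma fps_coefD (F : fieldType) (f g : fps F) n :
  fps_coef (f + g) n = fps_coef f n + fps_coef g n.
Proof. by []. Qed.

Lemma fps_coefN (F : fieldType) (f : fps F) n :
  fps_coef (- f) n = - fps_coef f n.
Proof. by []. Qed.

Lemma fps_coefM (F : fieldType) (f g : fps F) n :
  fps_coef (f * g) n = \sum_(i < n.+1) fps_coef f i * fps_coef g (n - i).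
Proof. by []. Qed.

Lemma fps_unitE (F : fieldType) (f : fps F) :
  (f \is a GRing.unit) = (fps_coef f 0 != 0).
Proof. by []. Qed.

Definition fps_X (F : fieldType) : fps F := FPS (fun n => (n == 1%N)%:R).

Lemma fps_coefXM (F : fieldType) (f : fps F) n :
  fps_coef (fps_X F * f) n = if n is m.+1 then fps_coef f m else 0.
Proof.
rewrite fps_coefM; case: n => [|n]; first by rewrite big_ord1 /= mul0r.
rewrite big_ord_recl /= mul0r add0r big_ord_recl /= mul1r subn1 /=.
by rewrite big1 ?addr0 // => i _; rewrite mul0r.
Qed.

Lemma fps_coefXnM (F : fieldType) (f : fps F) k n :
  fps_coef (fps_X F ^+ k * f) n
  = if (n < k)%N then 0 else fps_coef f (n - k).
Proof.
elim: k n => [|k IHk] n; first by rewrite expr0 mul1r subn0.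
by rewrite exprS -mulrA fps_coefXM; case: n => [|n] //; rewrite IHk.
Qed.

Local Notation "x %:F" := (tofrac x) : ring_scope.

Definition fps_map (F K : Type) (phi : F -> K) (f : fps F) : fps K :=
  FPS (fun n => phi (fps_coef f n)).

(* The substitution f(c z). *)
Definition fps_scale (F : fieldType) (c : F) (f : fps F) : fps F :=
  FPS (fun n => c ^+ n * fps_coef f n).

(* S is the coefficientwise sum of the u l over l >= m, every coefficient
   receiving only finitely many nonzero contributions. *)
Definition fps_has_sum (F : fieldType) (m : nat) (u : nat -> fps F)
    (S : fps F) : Prop :=
  forall n, exists N : nat,
    (forall l, (N <= l)%N -> fps_coef (u l) n = 0) /\
    fps_coef S n = \sum_(m <= l < N) fps_coef (u l) n.

Definition fps_exp (F : fieldType) : fps F := FPS (fun n => n`!%:R^-1).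

(* The Laurent series field Q((z)) is the fraction field of Q[[z]]. *)
Definition laurentQ : {fraction (fps rat)} :=
  ((fps_exp rat - 1)%:F)^-1.

Definition laurentC (l : nat) : {fraction (fps rat)} :=
  (fps_X rat ^+ l)%:F / l`!%:R * laurentQ.

(* laurentC l as an element of Q[[z]]; see Cser_laurent. For l = 0 it is not a
   power series, and the default value 0 is never used. *)
Definition Cser (l : nat) : fps rat :=
  xget 0 [set f : fps rat | f%:F = laurentC l]%classic.

Lemma Cser_laurent l : (0 < l)%N -> (Cser l)%:F = laurentC l.
Proof.
case: l => // l _; apply: (@xgetPex _ 0 [set f | f%:F = laurentC l.+1]%classic).
pose E : fps rat := FPS (fun n => n.+1`!%:R^-1).
have XE : fps_exp rat - 1 = fps_X rat * E.
  apply/fpsP => n; rewrite fps_coefD fps_coefN fps_coef1 fps_coefXM.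
  by case: n => [|n] /=; rewrite ?subr0 // fact0 invr1 subrr.
have uE : E \is a GRing.unit by rewrite fps_unitE [fps_coef _ _]/= invr_eq0 pnatr_eq0 -lt0n fact_gt0.
have E0 : E%:F != 0 by rewrite tofrac_eq0; apply: contraTneq uE => ->; rewrite unitr0.
have X0 : (fps_X rat)%:F != 0.
  rewrite tofrac_eq0; apply/eqP => /fpsP/(_ 1%N) /eqP.
  by rewrite /= oner_eq0.
have fl : (l.+1`!%:R : fps rat) \is a GRing.unit.
  have -> : (l.+1`!%:R : fps rat) = FPS (fun n => (n == 0%N)%:R * l.+1`!%:R).
    elim: (l.+1`!) => [|m IHm]; apply/fpsP => n; first by rewrite /= mulr0.
    by rewrite -[in LHS]addn1 natrD IHm fps_coefD /= -addn1 natrD mulrDr mulr1.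
  by rewrite fps_unitE /= mul1r pnatr_eq0 -lt0n fact_gt0.
have fF : (l.+1`!%:R : {fraction (fps rat)}) = (l.+1`!%:R : fps rat)%:F.
  by rewrite rmorph_nat.
have VF (u : fps rat) : u \is a GRing.unit -> (u^-1)%:F = (u%:F)^-1.
  exact: rmorphV.
exists (fps_X rat ^+ l * E^-1 / l.+1`!%:R).
rewrite /mkset /laurentC /laurentQ XE fF.
rewrite [LHS]tofracM [X in X * _]tofracM !VF //.
by rewrite exprSr !tofracM invfM [RHS]mulrAC mulrA mulfK.
Qed.

Definition imQ : rat[i] := Complex 0 1.

Definition Cz (l : nat) : fps rat[i] := fps_map (real_complex rat) (Cser l).

Definition Ciz (l : nat) : fps rat[i] := fps_scale imQ (Cz l).

Definition Dser (l : nat) : fps rat[i] :=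
  - Cz l - Ciz l + \sum_(1 <= a < l) Cz a * Ciz (l - a).

Definition gaussG (n p : nat) : rat[i] :=
  \sum_(1 <= a < p) \sum_(1 <= b < p) (a%:R + b%:R * imQ) ^+ n.

Definition egfG (p : nat) : fps rat[i] :=
  FPS (fun n => gaussG n p / n`!%:R).

(* The rationals lying in the localization Z_(p). *)
Definition Zloc (p : nat) : {pred rat} :=
  [pred x : rat | ~~ (p %| `|denq x|)%N].

(* Z_(p)[i] inside Q(i). *)
Definition Zloc_i (p : nat) : {pred rat[i]} :=
  [pred x : rat[i] | (complex.Re x \in Zloc p) && (complex.Im x \in Zloc p)].

(* x = y mod p^k in Z_(p)[i]. *)
Definition eqmod_loc (p k : nat) (x y : rat[i]) : Prop :=
  exists2 w : rat[i], w \in Zloc_i p & x - y = p%:R ^+ k * w.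

(* Main.v *)
Require Import Defs.
From HB Require Import structures.
From mathcomp Require Import all_boot all_order all_algebra.
From mathcomp Require Import complex.
From mathcomp Require Import zify ring.
From mathcomp Require boolp.
Import GRing.Theory Num.Theory.
Local Open Scope ring_scope.

(** Summing a geometric progression,
    [sum_(1 <= a < p) e^(a z) = (e^(p z) - e^z) / (e^z - 1)
                              = (e^(p z) - 1) Q(z) - 1],
    and expanding [e^(p z) - 1] in powers of [p] turns the first factor into
    [A(z) = sum_(l >= 1) p^l C_l(z)].  Since [e^((a + b i) z)] splits as
    [e^(a z) e^(b i z)], the exponential generating function of the [G_n(p)] is
    the product of two such sums, namely
      [(A(z) - 1) (A(i z) - 1) = 1 - A(z) - A(i z) + A(z) A(i z)],
    and collecting the terms of weight [p^l], with a Cauchy product for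
    [A(z) A(i z)], leaves [1 + sum_l p^l D_l(z)].  Division by [e^z - 1] is
    replaced throughout by multiplication: [l! C_l(z) (e^z - 1) = z^l]
    determines [C_l], because power series over a field form a domain
    ([Cser_exp], [sum_exp_Cgen], [egfG_prod], [egfG_sum]).

    For the congruence it is enough that every [[z^n] D_l] with [l >= 1] and
    [n <= p - 2] is integral at [p] ([Zloc_i_Dser]): the terms with [l > M] of
    the exact, finite formula for [G_n(p)] are then divisible by [p^(M + 1)].
    As [C_l] is [z^(l-1) C_1 / l!] and starts in degree [l - 1], this reduces
    to the coefficients of [C_1 = z Q], for which the recursion coming from
    [C_1(z) (e^z - 1) = z] only divides by factorials of numbers less than
    [p] in this range ([Zloc_C1]). *)

(** * Formal power series *)

Lemma fps_coef_sum (F : fieldType) (I : Type) (r : seq I) (P : pred I)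
    (u : I -> fps F) n :
  fps_coef (\sum_(i <- r | P i) u i) n = \sum_(i <- r | P i) fps_coef (u i) n.
Proof. exact: (big_morph (fun f : fps F => fps_coef f n)). Qed.

Lemma fps_coef_natM (F : fieldType) (m : nat) (f : fps F) n :
  fps_coef (m%:R * f) n = m%:R * fps_coef f n.
Proof.
rewrite !mulr_natl; elim: m => // m IHm.
by rewrite !mulrS fps_coefD IHm.
Qed.

Lemma fps_coef_Xn (F : fieldType) k n :
  fps_coef (fps_X F ^+ k) n = (n == k)%:R.
Proof.
rewrite -[_ ^+ k]mulr1 fps_coefXnM fps_coef1.
by case: ltngtP => [//|kn|->]; rewrite ?subnn // subn_eq0 leqNgt kn.
Qed.

Section FpsMorphisms.
Context {F K : fieldType} (phi : {rmorphism F -> K}).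

Lemma fps_map_is_zmod_morphism :
  zmod_morphism (fps_map phi : fps F -> fps K).
Proof. by move=> f g; apply/fpsP => n; rewrite /= rmorphB. Qed.

Lemma fps_map_is_monoid_morphism :
  monoid_morphism (fps_map phi : fps F -> fps K).
Proof.
split=> [|f g]; apply/fpsP => n; first by rewrite /= rmorph_nat.
by rewrite /= rmorph_sum; apply: eq_bigr => i _; rewrite rmorphM.
Qed.

HB.instance Definition _ := GRing.isZmodMorphism.Build (fps F) (fps K)
  (fps_map phi : fps F -> fps K) fps_map_is_zmod_morphism.
HB.instance Definition _ := GRing.isMonoidMorphism.Build (fps F) (fps K)
  (fps_map phi : fps F -> fps K) fps_map_is_monoid_morphism.

Lemma fps_map_X : fps_map phi (fps_X F) = fps_X K.
Proof. by apply/fpsP => n; rewrite /= rmorph_nat. Qed.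

Lemma fps_map_exp : fps_map phi (fps_exp F) = fps_exp K.
Proof. by apply/fpsP => n; rewrite /= fmorphV rmorph_nat. Qed.

Variable c : F.

Lemma fps_scale_is_zmod_morphism : zmod_morphism (@fps_scale F c).
Proof. by move=> f g; apply/fpsP => n; rewrite /= mulrBr. Qed.

Lemma fps_scale_is_monoid_morphism : monoid_morphism (@fps_scale F c).
Proof.
split=> [|f g]; apply/fpsP => n.
  by rewrite /=; case: n => [|n]; rewrite ?expr0 ?mulr1 ?mulr0.
rewrite /= mulr_sumr; apply: eq_bigr => i _.
by rewrite mulrACA -exprD subnKC // -ltnS.
Qed.

HB.instance Definition _ := GRing.isZmodMorphism.Build (fps F) (fps F)
  (@fps_scale F c) fps_scale_is_zmod_morphism.
HB.instance Definition _ := GRing.isMonoidMorphism.Build (fps F) (fps F)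
  (@fps_scale F c) fps_scale_is_monoid_morphism.

End FpsMorphisms.

Lemma fps_scale_scale (F : fieldType) (c d : F) (f : fps F) :
  fps_scale c (fps_scale d f) = fps_scale (d * c) f.
Proof. by apply/fpsP => n; rewrite /= mulrA -exprMn [c * d]mulrC. Qed.

Lemma fps_expD (F : fieldType) (c d : F) : [pchar F] =i pred0 ->
  fps_scale (c + d) (fps_exp F)
  = fps_scale c (fps_exp F) * fps_scale d (fps_exp F).
Proof.
move=> /pcharf0P F0; apply/fpsP => n.
rewrite fps_coefM /= [c + d]addrC exprDn mulr_suml.
apply: eq_bigr => i _; have le_in : (i <= n)%N by rewrite -ltnS.
rewrite -(bin_fact le_in) !natrM -mulr_natr !invfM.
have nz m : (m`!%:R : F) != 0 by rewrite F0 -lt0n fact_gt0.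
have bz : ('C(n, i)%:R : F) != 0 by rewrite F0 -lt0n bin_gt0.
rewrite [in RHS]mulrACA [d ^+ _ * _]mulrC -!mulrA; congr (_ * (_ * _)).
by rewrite mulVKf.
Qed.

Lemma fps_expB1_neq0 (F : fieldType) : fps_exp F - 1 != 0.
Proof.
apply/eqP => /fpsP/(_ 1%N)/eqP.
by rewrite fps_coefD fps_coefN /= subr0 invr1 oner_eq0.
Qed.

(** * Coefficientwise sums *)

Lemma sum_nat_trim {V : nmodType} {f : nat -> V} {m N K : nat} : (N <= K)%N ->
    (forall i, (N <= i)%N -> f i = 0) ->
  \sum_(m <= i < K) f i = \sum_(m <= i < N) f i.
Proof.
move=> NK f0; rewrite (big_nat_widen _ _ _ _ _ NK) [LHS](bigID (ltn^~ N)) /=.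
rewrite [X in _ + X]big1 ?addr0 // => i.
by rewrite -leqNgt => /f0.
Qed.

(** The triangle [a + b < N + N] contains the square [a, b < N], outside of which
    [f] vanishes. *)
Lemma sum_Cauchy {V : nmodType} (f : nat -> nat -> V) (N : nat) :
    (forall a b, (N <= a)%N || (N <= b)%N -> f a b = 0) ->
  \sum_(1 <= l < N + N) \sum_(1 <= a < l) f a (l - a)%N
  = \sum_(1 <= a < N) \sum_(1 <= b < N) f a b.
Proof.
move=> f0.
transitivity (\sum_(1 <= l < N + N) \sum_(1 <= a < N + N | (a < l)%N)
                f a (l - a)%N).
  by apply: eq_big_nat => l /andP[_ /ltnW lN]; apply: big_nat_widen.
rewrite (exchange_big_dep_nat xpredT) //=.
rewrite (sum_nat_trim (leq_addl N N)) => [|a Na]; last first.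
  by rewrite big1 // => l _; rewrite f0 ?Na.
apply: eq_big_nat => a /andP[_ aN].
rewrite -(big_nat_widenl _ _ _ xpredT) // -add1n big_addn.
under eq_bigr do rewrite addnK.
rewrite (@sum_nat_trim _ _ _ N) //; first lia.
by move=> b Nb; rewrite f0 ?Nb ?orbT.
Qed.

Section CoefficientwiseSums.
Context {F : fieldType}.
Implicit Types (u v : nat -> fps F) (S T g : fps F).

(** The bound on the number of nonzero contributions depends on the coefficient;
    products involve all the coefficients up to a given one, hence need a common
    bound. *)
Lemma fps_has_sum_unif {m u S} : fps_has_sum m u S -> forall n,
  exists N : nat,
    (forall k l, (k <= n)%N -> (N <= l)%N -> fps_coef (u l) k = 0) /\
    (forall k K, (k <= n)%N -> (N <= K)%N ->
       fps_coef S k = \sum_(m <= l < K) fps_coef (u l) k).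
Proof.
move=> uS n; pose N k := projT1 (boolp.cid (uS k)).
have NP k : (forall l, (N k <= l)%N -> fps_coef (u l) k = 0) /\
    fps_coef S k = \sum_(m <= l < N k) fps_coef (u l) k.
  by rewrite /N; case: boolp.cid.
have le_N k : (k <= n)%N -> (N k <= \max_(i < n.+1) N i)%N.
  by rewrite -ltnS => kn; apply: (leq_bigmax (Ordinal kn)).
exists (\max_(i < n.+1) N i); split=> k l /le_N/leq_trans le_kN /le_kN {}le_kN.
  exact: (NP k).1.
by rewrite (NP k).2 (sum_nat_trim le_kN) //; exact: (NP k).1.
Qed.

Lemma fps_has_sum_uniq {m u S T} :
  fps_has_sum m u S -> fps_has_sum m u T -> S = T.
Proof.
move=> uS uT; apply/fpsP => n.
have [N [_ SN]] := fps_has_sum_unif uS n.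
have [N' [_ TN]] := fps_has_sum_unif uT n.
by rewrite (SN n (maxn N N')) ?leq_maxl // (TN n (maxn N N')) ?leq_maxr.
Qed.

Lemma eq_fps_has_sum {m u v S} : u =1 v ->
  fps_has_sum m u S -> fps_has_sum m v S.
Proof.
move=> uv uS n; have [N [uN SN]] := uS n; exists N; split=> [l /uN|].
  by rewrite uv.
by rewrite SN; apply: eq_bigr => l _; rewrite uv.
Qed.

Lemma fps_has_sumD {m u v S T} : fps_has_sum m u S -> fps_has_sum m v T ->
  fps_has_sum m (fun l => u l + v l) (S + T).
Proof.
move=> uS vT n.
have [N [uN SN]] := fps_has_sum_unif uS n.
have [N' [vN TN]] := fps_has_sum_unif vT n.
exists (maxn N N'); split=> [l|].
  by rewrite geq_max => /andP[? ?]; rewrite fps_coefD uN ?vN ?addr0.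
rewrite fps_coefD (SN n (maxn N N')) ?leq_maxl //.
by rewrite (TN n (maxn N N')) ?leq_maxr // -big_split.
Qed.

Lemma fps_has_sumMr {m u S} g : fps_has_sum m u S ->
  fps_has_sum m (fun l => u l * g) (S * g).
Proof.
move=> uS n; have [N [uN SN]] := fps_has_sum_unif uS n.
exists N; split=> [l Nl|].
  by rewrite fps_coefM big1 // => i _; rewrite uN ?mul0r // -ltnS.
under [RHS]eq_bigr do rewrite fps_coefM.
rewrite exchange_big fps_coefM; apply: eq_bigr => i _.
by rewrite (SN i N) ?mulr_suml // -ltnS.
Qed.

Lemma fps_has_sumN {m u S} : fps_has_sum m u S ->
  fps_has_sum m (fun l => - u l) (- S).
Proof.
move=> uS n; have [N [uN SN]] := uS n; exists N; split=> [l /uN|].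
  by rewrite fps_coefN => ->; rewrite oppr0.
by rewrite fps_coefN SN -sumrN.
Qed.

Lemma fps_has_sum_scale c {m u S} : fps_has_sum m u S ->
  fps_has_sum m (fun l => fps_scale c (u l)) (fps_scale c S).
Proof.
move=> uS n; have [N [uN SN]] := uS n; exists N; split=> [l /uN|] /=.
  by move=> ->; rewrite mulr0.
by rewrite SN mulr_sumr.
Qed.

Lemma Cauchy_coefZ {R : comPzRingType} (t : R) (u v : nat -> R) l :
  \sum_(1 <= a < l) (t ^+ a * u a) * (t ^+ (l - a) * v (l - a)%N)
  = t ^+ l * \sum_(1 <= a < l) u a * v (l - a)%N.
Proof.
rewrite mulr_sumr; apply: eq_big_nat => a /andP[_ /ltnW al].
by rewrite mulrACA -exprD subnKC.
Qed.

Lemma fps_has_sumM {u v S T} : fps_has_sum 1 u S -> fps_has_sum 1 v T ->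
  fps_has_sum 1 (fun l => \sum_(1 <= a < l) u a * v (l - a)%N) (S * T).
Proof.
move=> uS vT n.
have [N1 [u0 SE]] := fps_has_sum_unif uS n.
have [N2 [v0 TE]] := fps_has_sum_unif vT n.
pose N := maxn N1 N2.
have uv0 a b : (N <= a)%N || (N <= b)%N -> fps_coef (u a * v b) n = 0.
  rewrite !geq_max fps_coefM => ab; apply: big1 => i _.
  case/orP: ab => /andP[? ?]; first by rewrite u0 ?mul0r // -ltnS.
  by rewrite v0 ?mulr0 // leq_subr.
exists (N + N)%N; split=> [l Nl|].
  rewrite fps_coef_sum big_nat_cond big1 // => a /andP[/andP[_ al] _].
  by apply: uv0; lia.
under eq_bigr do rewrite fps_coef_sum.
rewrite (sum_Cauchy (fun a b => fps_coef (u a * v b) n)) // fps_coefM.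
under [RHS]eq_bigr => a _ do under eq_bigr => b _ do rewrite fps_coefM.
under [RHS]eq_bigr => a _ do rewrite exchange_big.
rewrite exchange_big; apply: eq_bigr => i _ /=.
rewrite (SE i N) ?leq_maxl //; last by rewrite -ltnS.
rewrite (TE (n - i)%N N) ?leq_maxr ?leq_subr //.
by rewrite mulr_suml; apply: eq_bigr => a _; rewrite mulr_sumr.
Qed.

End CoefficientwiseSums.

(** * The generating function *)

Lemma pchar_gaussQ : [pchar rat[i]] =i pred0.
Proof.
apply/pcharf0P => n.
by rewrite -(rmorph_nat (real_complex rat)) fmorph_eq0 pnatr_eq0.
Qed.

(** Clearing the denominators in [C_l = z^l / (l! (e^z - 1))] gives an identity of
    power series, which determines [C_l] and from which all its properties
    follow. *)
Lemma Cser_exp l : (0 < l)%N ->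
  l`!%:R * Cser l * (fps_exp rat - 1) = fps_X rat ^+ l.
Proof.
move=> l0; apply/eqP; rewrite -tofrac_eq; apply/eqP.
rewrite !rmorphM /= Cser_laurent // /laurentC /laurentQ rmorph_nat.
have E0 : tofrac (fps_exp rat - 1) != 0 by rewrite tofrac_eq0 fps_expB1_neq0.
have lf0 : (l`!%:R : {fraction (fps rat)}) != 0.
  rewrite -(rmorph_nat (@tofrac _)) tofrac_eq0.
  apply/eqP => /fpsP/(_ 0%N)/eqP.
  rewrite -[l`!%:R]mulr1 fps_coef_natM.
  by rewrite /= mulr1; apply/negP; rewrite pnatr_eq0 -lt0n fact_gt0.
by rewrite -mulrA divfK // mulrC divfK // rmorphXn.
Qed.

Lemma fps_map_Cser_exp {K : fieldType} (phi : {rmorphism rat -> K}) l :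
    (0 < l)%N ->
  l`!%:R * fps_map phi (Cser l) * (fps_exp K - 1) = fps_X K ^+ l.
Proof.
move=> l0; rewrite -(fps_map_X phi) -(fps_map_exp phi) -rmorphXn -Cser_exp //.
by rewrite !rmorphM rmorphB rmorph1 rmorph_nat.
Qed.

Lemma Cz_exp l : (0 < l)%N ->
  l`!%:R * Cz l * (fps_exp rat[i] - 1) = fps_X rat[i] ^+ l.
Proof. exact: fps_map_Cser_exp. Qed.

(** Both [l! C_l] and [z^(l-1) C_1] give [z^l] when multiplied by [e^z - 1], hence
    are equal. *)
Lemma fps_coef_Cser l n : (0 < l)%N ->
  fps_coef (Cser l) n
  = if (n < l.-1)%N then 0 else l`!%:R^-1 * fps_coef (Cser 1) (n - l.-1).
Proof.
move=> l0; have lf0 : (l`!%:R : rat) != 0 by rewrite pnatr_eq0 -lt0n fact_gt0.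
apply: (mulfI lf0); rewrite -fps_coef_natM.
have -> : l`!%:R * Cser l = fps_X rat ^+ l.-1 * Cser 1.
  apply: (mulIf (fps_expB1_neq0 rat)); rewrite Cser_exp // -mulrA.
  by rewrite -[Cser 1]mul1r Cser_exp // -exprSr prednK.
rewrite fps_coefXnM; case: ifP => _; first by rewrite mulr0.
by rewrite mulVKf.
Qed.

Lemma fps_coef_Cz_eq0 l n : (n + 1 < l)%N -> fps_coef (Cz l) n = 0.
Proof.
move=> nl; rewrite /= fps_coef_Cser; last lia.
by rewrite ifT ?rmorph0 //; lia.
Qed.

(** The series [A(z)], the sum of all the [p^l C_l(z)]; as [C_l] starts in degree
    [l - 1], only [l <= n + 1] contributes to the coefficient of [z^n]. *)
Definition Cgen (p : nat) : fps rat[i] :=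
  FPS (fun n => \sum_(1 <= l < n.+2) p%:R ^+ l * fps_coef (Cz l) n).

Lemma fps_coef_natXM (F : fieldType) (p l : nat) (f : fps F) n :
  fps_coef (p%:R ^+ l * f) n = p%:R ^+ l * fps_coef f n.
Proof. by rewrite -!natrX fps_coef_natM. Qed.

Lemma Cgen_sum p : fps_has_sum 1 (fun l => p%:R ^+ l * Cz l) (Cgen p).
Proof.
move=> n; exists n.+2; split=> [l nl|].
  by rewrite fps_coef_natXM fps_coef_Cz_eq0 ?mulr0 // addn1.
by apply: eq_bigr => l _; rewrite fps_coef_natXM.
Qed.

(** Multiplying [p^l C_l] by [e^z - 1] gives [p^l z^l / l!], which is the term of
    degree [l] of [e^(p z)]. *)
Lemma Cgen_exp p :
  Cgen p * (fps_exp rat[i] - 1) = fps_scale p%:R (fps_exp rat[i]) - 1.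
Proof.
apply: fps_has_sum_uniq (fps_has_sumMr (fps_exp rat[i] - 1) (Cgen_sum p)) _.
have coefE l n : (0 < l)%N ->
    fps_coef (p%:R ^+ l * Cz l * (fps_exp rat[i] - 1)) n
    = if l == n then p%:R ^+ l / l`!%:R else 0.
  move=> l0.
  have lf0 : (l`!%:R : rat[i]) != 0.
    by rewrite ((pcharf0P _).1 pchar_gaussQ) -lt0n fact_gt0.
  rewrite -mulrA fps_coef_natXM.
  have -> : fps_coef (Cz l * (fps_exp rat[i] - 1)) n = l`!%:R^-1 * (n == l)%:R.
    apply: (mulfI lf0).
    by rewrite mulVKf // -fps_coef_natM mulrA Cz_exp // fps_coef_Xn.
  by rewrite eq_sym mulrA; case: eqP => _; rewrite ?mulr1 ?mulr0.
move=> n; exists n.+1; split=> [l nl|].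
  by rewrite coefE ?ifN //; lia.
under eq_big_nat => l /andP[l0 _] do rewrite coefE //.
rewrite -big_mkcond big_nat1_eq ltnSn andbT fps_coefD fps_coefN fps_coef1 /=.
by case: n => [|n] /=; rewrite ?subr0 // expr0 fact0 invr1 mulr1 subrr.
Qed.

(** Multiplied by [e^z - 1], the geometric progression telescopes to
    [e^(p z) - e^z]. *)
Lemma sum_exp_Cgen p : (0 < p)%N ->
  \sum_(1 <= a < p) fps_scale a%:R (fps_exp rat[i]) = Cgen p - 1.
Proof.
move=> p0; apply: (mulIf (fps_expB1_neq0 rat[i])).
have exp1 : fps_scale 1%:R (fps_exp rat[i]) = fps_exp rat[i].
  by apply/fpsP => n /=; rewrite expr1n mul1r.
rewrite mulrBl mul1r Cgen_exp mulr_suml.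
rewrite (telescope_sumr_eq (fun a => fps_scale a%:R (fps_exp rat[i]))) //.
  by rewrite exp1 opprB addrA subrK.
move=> a _; rewrite -addn1 natrD fps_expD; last exact: pchar_gaussQ.
by rewrite exp1 mulrBr mulr1.
Qed.

(** The exponentials [e^((a + b i) z)] are products of a factor depending on [a]
    and one depending on [b]. *)
Lemma egfG_prod p : egfG p =
  (\sum_(1 <= a < p) fps_scale a%:R (fps_exp rat[i])) *
  fps_scale imQ (\sum_(1 <= b < p) fps_scale b%:R (fps_exp rat[i])).
Proof.
have -> : fps_scale imQ (\sum_(1 <= b < p) fps_scale b%:R (fps_exp rat[i]))
    = \sum_(1 <= b < p) fps_scale (b%:R * imQ) (fps_exp rat[i]).
  by rewrite rmorph_sum; apply: eq_bigr => b _; exact: fps_scale_scale.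
rewrite mulr_suml; apply/fpsP => n.
rewrite fps_coef_sum [LHS]mulr_suml; apply: eq_bigr => a _.
rewrite mulr_sumr fps_coef_sum mulr_suml; apply: eq_bigr => b _.
by rewrite -fps_expD //; exact: pchar_gaussQ.
Qed.

Lemma egfG_sum p : (0 < p)%N ->
  fps_has_sum 1 (fun l => p%:R ^+ l * Dser l) (egfG p - 1).
Proof.
move=> p0; rewrite egfG_prod !sum_exp_Cgen // rmorphB rmorph1.
set A := Cgen p; set B := fps_scale imQ A.
have -> : (A - 1) * (B - 1) - 1 = - A - B + A * B by ring.
have scaleM l : fps_scale imQ (p%:R ^+ l * Cz l) = p%:R ^+ l * Ciz l.
  by rewrite rmorphM rmorphXn rmorph_nat.
have sA := Cgen_sum p; have sB := fps_has_sum_scale imQ sA.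
have := fps_has_sumD (fps_has_sumD (fps_has_sumN sA) (fps_has_sumN sB))
          (fps_has_sumM sA sB).
apply: eq_fps_has_sum => l.
under eq_bigr do rewrite scaleM.
by rewrite /Dser mulrDr mulrBr mulrN -scaleM Cauchy_coefZ.
Qed.

(** * Integrality at p *)

(** The fraction need not be reduced: its reduced denominator divides [d]. *)
Lemma Zloc_div p (a : int) (d : nat) :
  ~~ (p %| d)%N -> a%:~R / d%:R \in Zloc p.
Proof.
move=> pd; rewrite inE; set x := _ / _.
apply: contra pd => /dvdn_trans; apply.
have [->|d0] := eqVneq d 0%N; first exact: dvdn0.
have xd : numq x * d%:Z = a * denq x.
  apply: (@intr_inj rat); rewrite !intrM numqE mulrAC; congr (_ * _).
  by rewrite /x -pmulrn divfK // pnatr_eq0.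
have /Gauss_dvdr <- : coprime `|denq x| `|numq x|.
  by rewrite coprime_sym coprime_num_den.
by rewrite -[d in X in (_ %| X)%N]/`|d%:Z|%N -abszM xd abszM dvdn_mull.
Qed.

Section Localization.
Context {p : nat} (p_prime : prime p).

Lemma Zloc_fracP (x : rat) : x \in Zloc p ->
  exists2 d : nat, ~~ (p %| d)%N & exists a : int, x = a%:~R / d%:R.
Proof.
move=> xp; exists `|denq x|%N => //; exists (numq x).
by rewrite -[LHS]divq_num_den -[in LHS]absz_denq -pmulrn.
Qed.

Lemma ZlocD : {in Zloc p &, forall x y, x + y \in Zloc p}.
Proof.
move=> _ _ /Zloc_fracP[d pd [a ->]] /Zloc_fracP[e pe [b ->]].
have nz (f : nat) : ~~ (p %| f)%N -> (f%:R : rat) != 0.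
  by rewrite pnatr_eq0; apply: contraNneq => ->.
rewrite addf_div ?nz // -natrM !pmulrn -!intrM -intrD -pmulrn.
by rewrite Zloc_div // Euclid_dvdM // negb_or pd.
Qed.

Lemma ZlocM : {in Zloc p &, forall x y, x * y \in Zloc p}.
Proof.
move=> _ _ /Zloc_fracP[d pd [a ->]] /Zloc_fracP[e pe [b ->]].
rewrite mulrACA -invfM -natrM -intrM.
by rewrite Zloc_div // Euclid_dvdM // negb_or pd.
Qed.

Lemma Zloc_int (a : int) : a%:~R \in Zloc p.
Proof.
by rewrite -[a%:~R]divr1 -[1]/(1%:R) Zloc_div // dvdn1 neq_ltn prime_gt1 ?orbT.
Qed.

Lemma Zloc_nat (m : nat) : m%:R \in Zloc p.
Proof. by rewrite pmulrn Zloc_int. Qed.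

Lemma ZlocN : {in Zloc p, forall x, - x \in Zloc p}.
Proof. by move=> x xp; rewrite -mulN1r ZlocM // (Zloc_int (-1)). Qed.

Lemma Zloc_sum (I : Type) (r : seq I) (P : pred I) (u : I -> rat) :
  (forall i, P i -> u i \in Zloc p) -> \sum_(i <- r | P i) u i \in Zloc p.
Proof.
by move=> up; elim/big_ind: _ => //; [exact: Zloc_nat 0%N | exact: ZlocD].
Qed.

Lemma Zloc_factV (n : nat) : (n < p)%N -> n`!%:R^-1 \in Zloc p.
Proof.
move=> np; rewrite -[_^-1]mul1r -[1]/(1%:~R) Zloc_div //.
elim: n np => [|n IHn] np; first by rewrite dvdn1 neq_ltn prime_gt1 ?orbT.
by rewrite factS Euclid_dvdM // negb_or IHn 1?ltnW // gtnNdvd.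
Qed.

(** The coefficients of [C_1] are [B_n / n!]. The coefficient of [z^(n+1)] in
    [C_1(z) (e^z - 1) = z] expresses the [n]th one through the previous ones
    with the coefficients [1 / (n + 1 - i)!], and [n + 1 < p]. *)
Lemma Zloc_C1 n : (n <= p - 2)%N -> fps_coef (Cser 1) n \in Zloc p.
Proof.
have := Cser_exp 1%N isT; rewrite mul1r expr1 => C1E.
elim/ltn_ind: n => n IHn np.
have /fpsP/(_ n.+1) := C1E.
rewrite fps_coefM big_ord_recr /= subnn subrr mulr0 addr0.
rewrite big_ord_recr /= subSnn invr1 subr0 mulr1.
move/(canRL (addKr _)) => ->; rewrite eqSS.
rewrite ZlocD ?Zloc_nat ?ZlocN // Zloc_sum // => i _.
rewrite ZlocM ?IHn //; first by rewrite (leq_trans _ np) // ltnW.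
rewrite subSn; last exact: ltnW.
by rewrite subr0 Zloc_factV //; have := prime_gt1 p_prime; lia.
Qed.

(** Large [l] are harmless although [l!] is then divisible by [p]: the coefficient
    is nonzero only if [l - 1 <= n], and then [l < p]. *)
Lemma Zloc_Cser l n : (0 < l)%N -> (n <= p - 2)%N ->
  fps_coef (Cser l) n \in Zloc p.
Proof.
move=> l0 np; rewrite fps_coef_Cser //; case: ltnP => nl.
  exact: Zloc_nat 0%N.
by rewrite ZlocM ?Zloc_C1 ?Zloc_factV //; have := prime_gt1 p_prime; lia.
Qed.

Lemma Zloc_iD : {in Zloc_i p &, forall x y, x + y \in Zloc_i p}.
Proof.
by move=> [a b] [c d]; rewrite !inE => /andP[? ?] /andP[? ?];
   apply/andP; split; apply: ZlocD.
Qed.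

Lemma Zloc_iM : {in Zloc_i p &, forall x y, x * y \in Zloc_i p}.
Proof.
move=> [a b] [c d]; rewrite !inE => /andP[? ?] /andP[? ?].
apply/andP; split; apply: ZlocD; try exact: ZlocM.
by apply: ZlocN; exact: ZlocM.
Qed.

Lemma Zloc_i_real : {in Zloc p, forall x, real_complex rat x \in Zloc_i p}.
Proof. by move=> x xp; apply/andP; split=> //; exact: Zloc_nat 0%N. Qed.

Lemma Zloc_i_nat (m : nat) : m%:R \in Zloc_i p.
Proof. by rewrite -(rmorph_nat (real_complex rat)) Zloc_i_real ?Zloc_nat. Qed.

Lemma Zloc_iN : {in Zloc_i p, forall x, - x \in Zloc_i p}.
Proof.
by move=> [a b] /andP[? ?]; apply/andP; split; apply: ZlocN.
Qed.

Lemma Zloc_i_sum (I : Type) (r : seq I) (P : pred I) (u : I -> rat[i]) :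
  (forall i, P i -> u i \in Zloc_i p) -> \sum_(i <- r | P i) u i \in Zloc_i p.
Proof.
by move=> up; elim/big_ind: _ => //; [exact: Zloc_i_nat 0%N | exact: Zloc_iD].
Qed.

Lemma Zloc_iX (x : rat[i]) n : x \in Zloc_i p -> x ^+ n \in Zloc_i p.
Proof.
move=> xp; elim: n => [|n IHn]; first exact: Zloc_i_nat 1%N.
by rewrite exprS Zloc_iM.
Qed.

Lemma Zloc_i_imQ : imQ \in Zloc_i p.
Proof. by apply/andP; split; [exact: Zloc_nat 0%N | exact: Zloc_nat 1%N]. Qed.

(** Each coefficient of a product involves only coefficients of the factors in
    degrees at most [n], to which [Zloc_Cser] applies. *)
Lemma Zloc_i_Dser l n : (0 < l)%N -> (n <= p - 2)%N ->
  fps_coef (Dser l) n \in Zloc_i p.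
Proof.
have Cz_p k m : (0 < k)%N -> (m <= p - 2)%N -> fps_coef (Cz k) m \in Zloc_i p.
  by move=> k0 mp; rewrite Zloc_i_real ?Zloc_Cser.
have Ciz_p k m : (0 < k)%N -> (m <= p - 2)%N ->
    fps_coef (Ciz k) m \in Zloc_i p.
  by move=> k0 mp; rewrite Zloc_iM ?Zloc_iX ?Zloc_i_imQ ?Cz_p.
move=> l0 np; rewrite /Dser !fps_coefD !fps_coefN fps_coef_sum.
rewrite !Zloc_iD ?Zloc_iN ?Cz_p ?Ciz_p // big_nat_cond Zloc_i_sum //.
move=> a /andP[/andP[a0 al] _]; rewrite fps_coefM Zloc_i_sum // => i _.
by rewrite Zloc_iM ?Cz_p ?Ciz_p ?subn_gt0 //; have := ltn_ord i; lia.
Qed.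

End Localization.

Theorem lemma5 (p : nat) (p_prime : prime p) (p_odd : odd p) :
  (exists2 S : fps rat[i],
     fps_has_sum 1 (fun l : nat => p%:R ^+ l * Dser l) S & egfG p = 1 + S)
  /\
  (forall n M : nat, (1 <= n)%N -> (n <= p - 2)%N -> (1 <= M)%N ->
     eqmod_loc p M.+1 (gaussG n p)
       (n`!%:R * \sum_(1 <= l < M.+1) p%:R ^+ l * fps_coef (Dser l) n)).
Proof.
have Dsum := egfG_sum p (prime_gt0 p_prime).
split; first by exists (egfG p - 1); rewrite // addrC subrK.
move=> n M n_gt0 np _.
have [N [_ SN]] := fps_has_sum_unif Dsum n.
(* Sums up to [K] still give the exact value, and contain the first [M] terms. *)
pose K := maxn N M.+1.
have fn0 : (n`!%:R : rat[i]) != 0.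
  by rewrite ((pcharf0P _).1 pchar_gaussQ) -lt0n fact_gt0.
have GE : gaussG n p
    = n`!%:R * \sum_(1 <= l < K) p%:R ^+ l * fps_coef (Dser l) n.
  have := SN n K (leqnn n) (leq_maxl _ _).
  rewrite fps_coefD fps_coefN fps_coef1 gtn_eqF // subr0.
  move/(canRL (divfK fn0)) => ->; rewrite mulrC.
  by congr (_ * _); apply: eq_bigr => l _; rewrite fps_coef_natXM.
exists (n`!%:R * \sum_(M.+1 <= l < K) p%:R ^+ (l - M.+1) * fps_coef (Dser l) n).
  rewrite Zloc_iM ?Zloc_i_nat // big_nat_cond Zloc_i_sum //.
  move=> l /andP[/andP[Ml _] _].
  by rewrite Zloc_iM ?Zloc_iX ?Zloc_i_nat ?Zloc_i_Dser //; lia.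
rewrite GE (@big_cat_nat _ _ _ M.+1) ?leq_maxr //= mulrDr addrC addKr.
rewrite mulrCA; congr (_ * _); rewrite mulr_sumr.
apply: eq_big_nat => l /andP[Ml _].
by rewrite mulrA -exprD subnKC.
Qed.
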